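(* Let $n>1$ be an integer, let $K$ be a number field of degree $n$, and let $p$ be a rational prime. Let $c_7(n) = \max_{0\le d\le n-1} \frac{d(n-1-d)}{n-1+d}$, the maximum being over all integers $d$ with $0\le d\le n-1$. Then: (1) The series $\tilde{\eta}_{K,p}(s)$ diverges for all $s\in\mathbb{C}$ such that $\operatorname{Re}(s)\le \frac{c_7(n)}{2}$. (2) The series $\tilde{\eta}_{K,p}(s)$ diverges for all $s\in\mathbb{C}$ such that $$\operatorname{Re}(s)\le \frac{(3-2\sqrt{2})(n-1)+1-\sqrt{2}}{2}.$$
   Context: Let $\mathcal{O}_K$ be the ring of integers of $K$. An order in $\mathcal{O}_K$ is a finite index subring of $\mathcal{O}_K$ containing the multiplicative identity. Let $\tilde{\eta}_K(s)=\sum_{\mathcal{O}}[\mathcal{O}_K:\mathcal{O}]^{-s}$, the sum being over all orders $\mathcal{O}$ of $\mathcal{O}_K$. It has an Euler product $\tilde\eta_K(s)=\prod_p\tilde\eta_{K,p}(s)$ over rational primes, where $\tilde{\eta}_{K,p}(s)=\sum_{\mathcal{O}}[\mathcal{O}_K\otimes_{\mathbb{Z}}\mathbb{Z}_p:\mathcal{O}]^{-s}$, the sum being over finite index unital $\mathbb{Z}_p$-subalgebras $\mathcal{O}$ of $\mathcal{O}_K\otimes_{\mathbb{Z}}\mathbb{Z}_p$; equivalently, $\tilde{\eta}_{K,p}(s)=\sum_{e\ge 0} N_{K}(p^e)p^{-es}$, where $N_K(p^e)$ is the number of orders of index $p^e$ in $\mathcal{O}_K$. *)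

(* Defs.v *)
From HB Require Import structures.
From mathcomp Require Import all_boot all_order all_algebra all_field.
From mathcomp Require Import complex.
From mathcomp Require Import finmap.
From mathcomp Require Import all_classical all_reals all_analysis.
Import Order.TTheory GRing.Theory Num.Theory.
Import numFieldNormedType.Exports.
Local Open Scope classical_set_scope.
Local Open Scope ring_scope.

Definition cosets {V : zmodType} (A B : set V) : set (set V) :=
  [set [set x + b | b in B] | x in A].

(* [fset_set] sends an infinite set to [fset0], so an infinite index is 0. *)
Definition set_index {V : zmodType} (A B : set V) : nat :=
  #|` fset_set (cosets A B)|.

Definition ring_of_integers (K : fieldExtType rat) : set K :=
  [set x | integralOver (intr : int -> K) x].

Definition is_order (K : fieldExtType rat) (O : set K) : Prop :=
  [/\ O `<=` ring_of_integers K,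
      GRing.subring_closed (mem O) &
      finite_set (cosets (ring_of_integers K) O)].

Definition orders_of_index (K : fieldExtType rat) (m : nat) : set (set K) :=
  [set O | is_order K O /\ set_index (ring_of_integers K) O = m].

(* There are finitely many orders of a given index, so the default value of
   [fset_set] on infinite sets plays no role here. *)
Definition num_orders (K : fieldExtType rat) (m : nat) : nat :=
  #|` fset_set (orders_of_index K m)|.

(* m ^ s = exp (s * ln m) for m > 0, split into modulus and argument. *)
Definition natcpow {R : realType} (m : nat) (s : R[i]) : R[i] :=
  let r := expR (complex.Re s * ln m%:R) in
  let t := complex.Im s * ln m%:R in
  ((r * cos t) +i* (r * sin t))%C.

Definition eta_term {R : realType} (K : fieldExtType rat) (p : nat) (s : R[i])
    (e : nat) : R[i]^o :=
  (num_orders K (p ^ e))%:R * natcpow p (- (e%:R * s)).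

Definition eta_converges {R : realType} (K : fieldExtType rat) (p : nat)
    (s : R[i]) : Prop :=
  cvgn (series (eta_term K p s)).

(* All the terms are nonnegative and the one for d = 0 is 0, so the default
   value 0 does not change the maximum. *)
Definition c7 (R : realType) (n : nat) : R :=
  \big[Num.max/0]_(d < n)
    (d%:R * (n%:R - 1 - d%:R) / (n%:R - 1 + d%:R)).

(* Main.v *)
(* Write n = m + 1.  By minimality of a trace determinant, O_K has a Z-basis
   1, X_1, .., X_m.  For N = p^k every lattice L with
     Z + N^2 O_K <= L <= Z + N O_K
   is an order, and (Z + N O_K) / (Z + N^2 O_K) is (Z/N)^m.  The graphs of the
   d x (m - d) matrices over Z/N give N^(d (m - d)) such L, all of index
   N^(m + d).  So when Re(s) <= d (m - d) / (m + d) the terms of the series do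
   not tend to 0. *)
From HB Require Import structures.
Require Import Defs.
From mathcomp Require Import all_boot all_order all_algebra all_field.
From mathcomp Require Import complex.
From mathcomp Require Import finmap.
From mathcomp Require Import all_classical all_reals all_analysis.
From mathcomp Require Import perm.
From mathcomp Require Import ring lra zify.
Import Order.TTheory GRing.Theory Num.Theory.
Import numFieldNormedType.Exports.
Local Open Scope classical_set_scope.
Local Open Scope ring_scope.

Set Implicit Arguments.
Unset Strict Implicit.

(** * Elements integral over the integers, and traces of rational matrices *)

Lemma intr_in_alg (F : fieldType) (A : falgType F) (z : int) :
  (z%:~R : F)%:A = z%:~R :> A.
Proof. exact: (rmorph_int (in_alg A)). Qed.

Lemma intr_falg_inj (A : falgType rat) : injective (intr : int -> A).
Proof.
move=> y z yz; apply: (@intr_inj rat); apply: (fmorph_inj (in_alg A)).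
by rewrite /= !intr_in_alg.
Qed.

Lemma Aint_int_root (p : {poly int}) (x : algC) :
  p \is monic -> root (map_poly intr p) x -> x \in Aint.
Proof.
move=> pmon px; apply: (root_monic_Aint px); first exact: monic_map.
by apply/polyOverP => i; rewrite coef_map /= intr_int.
Qed.

Lemma ratr_Aint (q : rat) : ratr q \in Aint -> q \is a Num.int.
Proof.
move=> qA; have : (ratr q : algC) \is a Num.int.
  by apply: Cint_rat_Aint => //; apply: Crat_rat.
by case/intrP => m; rewrite -(ratr_int algC m) => /fmorph_inj ->; apply: intr_int.
Qed.

(* The eigenvalues of A are algebraic integers. *)
Lemma mxtrace_int (n : nat) (A : 'M[rat]_n.+1) (p : {poly int}) :
  p \is monic -> horner_mx A (map_poly intr p) = 0 -> \tr A \is a Num.int.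
Proof.
move=> pmon pA0; apply: ratr_Aint.
pose B := map_mx (ratr : rat -> algC) A.
have pB0 : horner_mx B (map_poly intr p) = 0.
  have -> : map_poly intr p = map_poly (ratr : rat -> algC) (map_poly intr p).
    by rewrite -map_poly_comp; apply: eq_map_poly => z /=; rewrite ratr_int.
  by rewrite -map_horner_mx pA0 map_mx0.
have [r rE] := closed_field_poly_normal (char_poly B).
rewrite (monicP (char_poly_monic B)) scale1r in rE.
have rA : {in r, forall z, z \in Aint}.
  move=> z zr; apply: (@Aint_int_root p) => //.
  (* An eigenvalue is a root of the minimal polynomial, which divides [p]. *)
  have : root (mxminpoly B) z.
    by rewrite root_mxminpoly rE root_prod_XsubC.
  rewrite !root_factor_theorem => /dvdp_trans; apply.
  exact: mxminpoly_min.
(* Up to sign the trace is a coefficient of [char_poly B], so it suffices that these coefficients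
   are algebraic integers. *)
have cA : char_poly B \is a polyOver Aint.
  rewrite rE big_seq; apply: rpred_prod => z /rA zA.
  by rewrite polyOverXsubC.
have -> : ratr (\tr A) = \tr B :> algC.
  by rewrite /mxtrace rmorph_sum; apply: eq_bigr => i _; rewrite mxE.
by rewrite -[\tr B]opprK -char_poly_trace // rpredN; apply: (polyOverP cA).
Qed.

Lemma integral_intr_rat (K : fieldExtType rat) (q : rat) :
  integralOver (intr : int -> K) q%:A -> q \is a Num.int.
Proof.
case=> p pmon pq; apply: ratr_Aint; apply: (@Aint_int_root p) => //.
have -> : map_poly intr p = map_poly (ratr : rat -> algC) (map_poly intr p).
  by rewrite -map_poly_comp; apply: eq_map_poly => z /=; rewrite ratr_int.
rewrite fmorph_root -(fmorph_root (in_alg K)) -map_poly_comp /=.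
congr root: pq; apply: eq_map_poly => z /=.
by rewrite intr_in_alg.
Qed.

Lemma integral_clear_denominator (K : fieldExtType rat) (x : K) :
  exists2 c : int, c != 0 & integralOver (intr : int -> K) (x *~ c).
Proof.
have [q qmon qx] := @alg_integral rat K x.
have [r [a an0 qE]] := rat_poly_scale q.
have rx : root (map_poly (intr : int -> K) r) x.
  move: qx; rewrite qE map_polyZ rootZ /=; last first.
    by rewrite scaler_eq0 oner_eq0 orbF invr_eq0 intr_eq0.
  rewrite -map_poly_comp; congr root; apply: eq_map_poly => z /=.
  by rewrite intr_in_alg.
have rn0 : r != 0.
  by apply: contraTneq qmon => r0; rewrite qE r0 rmorph0 scaler0 monicE lead_coef0.
have [n rn] : exists n, size r = n.+2.
  have rKn0 : map_poly (intr : int -> K) r != 0.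
    rewrite -(rmorph0 (map_poly (intr : int -> K))).
    by rewrite (inj_eq (map_inj_poly (@intr_falg_inj K) (rmorph0 _))).
  have := root_size_gt1 rKn0 rx.
  rewrite size_map_inj_poly ?rmorph0 //; last exact: intr_falg_inj.
  by case: (size r) => [|[|n]] // _; exists n.
(* This is a^n r(X / a), with a the leading coefficient and n + 1 the degree of [r]; it is monic and
   vanishes at a x. The top coefficient is set apart because n - i truncates at i = n + 1. *)
pose s := \poly_(i < n.+2)
  (if i == n.+1 then 1 else r`_i * lead_coef r ^+ (n - i)) : {poly int}.
exists (lead_coef r); first by rewrite lead_coef_eq0.
have size_s : size s = n.+2 by rewrite size_poly_eq // eqxx.
exists s; first by rewrite monicE /lead_coef size_s coef_poly ltnSn eqxx.
apply/rootP; move/rootP: rx; rewrite !horner_coef.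
rewrite !size_map_inj_poly ?rmorph0 //; try exact: intr_falg_inj.
rewrite size_s rn => /(congr1 ( *%R ((lead_coef r)%:~R ^+ n))).
rewrite mulr0 mulr_sumr => rx0; rewrite -[RHS]rx0; apply: eq_bigr => i _.
rewrite !coef_map coef_poly ltn_ord /=.
rewrite -[x *~ _]mulrzr exprMn.
rewrite [x ^+ i * _]mulrC !mulrA; congr (_ * _).
case: eqP => [iE|/eqP iN]; first by rewrite iE mul1r exprSr /lead_coef rn.
rewrite rmorphM rmorphXn /= -mulrA -exprD subnK; first exact: mulrC.
by move: (ltn_ord i); rewrite ltnS leq_eqVlt (negbTE iN).
Qed.

(** * The trace form of K and its Gram determinants *)

Section Trace.
Variables (K : fieldExtType rat) (m : nat).
Variable X : m.+1.-tuple K.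
Hypothesis basX : basis_of {:K} X.

(** Regular representation of K, with images of basis vectors stored in rows. *)
Definition mulrep (x : K) : 'M[rat]_m.+1 := \matrix_(i, j) coord X j (x * X`_i).

Definition ftrace (x : K) : rat := \tr (mulrep x).

Lemma mulrep_is_linear : linear mulrep.
Proof.
by move=> a x y; apply/matrixP => i j; rewrite !mxE mulrDl -scalerAl linearP.
Qed.

HB.instance Definition _ := GRing.isLinear.Build rat K 'M[rat]_m.+1 _ mulrep
  mulrep_is_linear.

HB.instance Definition _ := GRing.Linear.copy ftrace (mxtrace \o mulrep).

(** With images in rows the factors come out in reverse order; commutativity of K puts them back. *)
Lemma mulrepM x y : mulrep (x * y) = mulrep x *m mulrep y.
Proof.
apply/matrixP => i j; rewrite !mxE (mulrC x) -mulrA.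
rewrite {1}(coord_basis basX (memvf (x * X`_i))) mulr_sumr linear_sum.
by apply: eq_bigr => k _; rewrite !mxE -scalerAr linearZ.
Qed.

Lemma mulrep1 : mulrep 1 = 1%:M.
Proof.
apply/matrixP => i j; rewrite !mxE mul1r coord_free ?(basis_free basX) //.
Qed.

Lemma horner_mulrep p x :
  horner_mx (mulrep x) p = mulrep (map_poly (in_alg K) p).[x].
Proof.
elim/poly_ind: p => [|p c IH]; first by rewrite !rmorph0 horner0 linear0.
rewrite !rmorphD !rmorphM /= map_polyX map_polyC horner_mx_X horner_mx_C.
rewrite hornerD hornerM hornerX hornerC linearD /= mulrepM IH.
by rewrite linearZ /= mulrep1 scalemx1.
Qed.

Lemma ftrace_suml (I : finType) (q : I -> rat) (x : I -> K) y :
  ftrace ((\sum_i q i *: x i) * y) = \sum_i q i * ftrace (x i * y).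
Proof.
rewrite [X in ftrace X]mulr_suml linear_sum; apply: eq_bigr => i _.
by rewrite -scalerAl; apply: linearZ.
Qed.

Lemma ftrace_sumr (I : finType) (q : I -> rat) (x : I -> K) y :
  ftrace (y * \sum_i q i *: x i) = \sum_i q i * ftrace (y * x i).
Proof.
by rewrite (mulrC y) ftrace_suml; apply: eq_bigr => i _; rewrite [y * _]mulrC.
Qed.

(** A monic integer polynomial killing x also kills its multiplication matrix. *)
Lemma ftrace_int x : integralOver (intr : int -> K) x -> ftrace x \is a Num.int.
Proof.
case=> p pmon px; apply: (@mxtrace_int _ (mulrep x) p pmon).
rewrite horner_mulrep.
rewrite -map_poly_comp; have -> : map_poly (in_alg K \o intr) p = map_poly intr p.
  by apply: eq_map_poly => z /=; rewrite -(rmorph_int (in_alg K)).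
by rewrite (rootP px) linear0.
Qed.

(** For nonzero x, the trace of x x^-1 = 1 is the degree m + 1, which is nonzero in characteristic
    0. *)
Lemma ftrace_nondegenerate x : (forall y, ftrace (x * y) = 0) -> x = 0.
Proof.
move=> tr0; apply/eqP/negPn/negP => xn0; have := tr0 x^-1.
rewrite divff // /ftrace mulrep1 mxtrace1 => /eqP.
by rewrite pnatr_eq0.
Qed.

Implicit Types (b x : 'I_m.+1 -> K) (q : 'I_m.+1 -> rat).

(** Gram determinant of the trace form between two families; for [x = b] it is the discriminant.
    Holding [b] fixed makes it linear in each [x i]. *)
Definition trdet b x : rat := \det (\matrix_(i, j) ftrace (x i * b j)).

(** By linearity in row i, only the term l = i survives: for the others two rows coincide. *)
Lemma trdet_replace b x q i :
  trdet b (fun k => if k == i then \sum_l q l *: x l else x k)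
  = q i * trdet b x.
Proof.
pose D w := trdet b (fun k => if k == i then w else x k).
pose G w := \matrix_(k, j) ftrace ((if k == i then w else x k) * b j).
(* The cofactors along row i do not involve that row, so they may be read off [G 0]. *)
have DE w : D w = \sum_j ftrace (w * b j) * cofactor (G 0) i j.
  rewrite /D /trdet (expand_det_row _ i); apply: eq_bigr => j _.
  rewrite mxE eqxx; congr (_ * (_ * \det _)).
  by apply/matrixP => k l; rewrite !mxE eq_sym (negbTE (neq_lift _ _)).
have Dself : D (x i) = trdet b x.
  by congr (\det _); apply/matrixP => k l; rewrite !mxE; case: eqP => // ->.
have Dother k : k != i -> D (x k) = 0.
  move=> ki; apply: (determinant_alternate ki) => j.
  by rewrite !mxE eqxx (negbTE ki).
rewrite -[LHS]/(D _) -Dself DE.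
transitivity (\sum_l q l * D (x l)); last first.
  by rewrite (bigD1 i) //= big1 ?addr0 // => l /Dother ->; rewrite mulr0.
under [RHS]eq_bigr => l _ do rewrite DE mulr_sumr.
rewrite exchange_big; apply: eq_bigr => j _ /=.
rewrite ftrace_suml mulr_suml; apply: eq_bigr => l _; exact: esym (mulrA _ _ _).
Qed.

Lemma trdet_int b x :
  (forall i, integralOver (intr : int -> K) (b i)) ->
  (forall i, integralOver (intr : int -> K) (x i)) ->
  trdet b x \is a Num.int.
Proof.
move=> bI xI; apply: rpred_sum => s _; rewrite rpredMsign.
by apply: rpred_prod => i _; rewrite mxE; apply: ftrace_int; apply: integral_mul.
Qed.

(** A kernel vector of the Gram matrix would give a combination of the [b i] orthogonal to all of K,
    hence zero by nondegeneracy. *)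
Lemma trdet_diag_neq0 b :
  (forall y, exists q, y = \sum_i q i *: b i) ->
  (forall q, \sum_i q i *: b i = 0 -> forall i, q i = 0) ->
  trdet b b != 0.
Proof.
move=> bspan bfree; apply/negP => /det0P[v vn0 vG0].
suff z0 : \sum_i v 0 i *: b i = 0.
  by case/eqP: vn0; apply/rowP => i; rewrite mxE (bfree (v 0)).
apply: ftrace_nondegenerate => y; have [q ->] := bspan y.
rewrite ftrace_sumr big1 // => j _; rewrite ftrace_suml.
move/rowP/(_ j): vG0; rewrite !mxE => vG0j.
rewrite [X in _ * X](_ : _ = 0) ?mulr0 // -[RHS]vG0j.
by apply: eq_bigr => i _; rewrite mxE.
Qed.

(** Inverting the Gram matrix gives the coefficients: y minus the resulting combination is
    trace-orthogonal to every [b j], hence zero. *)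
Lemma trdet_span b x :
  (forall y, exists q, y = \sum_i q i *: b i) -> trdet b x != 0 ->
  forall y, exists q, y = \sum_i q i *: x i.
Proof.
move=> bspan dx y; pose G := \matrix_(i, j) ftrace (x i * b j).
pose v := (\row_j ftrace (y * b j)) *m invmx G; exists (v 0).
have vG : v *m G = \row_j ftrace (y * b j) by rewrite mulmxKV // unitmxE unitfE.
apply/eqP; rewrite -subr_eq0; apply/eqP; apply: ftrace_nondegenerate => z.
have [q ->] := bspan z; rewrite ftrace_sumr big1 // => j _.
rewrite mulrBl linearB /= ftrace_suml.
move/rowP/(_ j): vG; rewrite !mxE => <-.
rewrite -sumrB big1 ?mulr0 // => i _.
by rewrite [G i j]mxE subrr.
Qed.

End Trace.

(** * Existence of an integral basis containing 1 *)

Lemma integral_scale_int (K : fieldExtType rat) (q : rat) (x : K) :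
  q \is a Num.int -> integralOver (intr : int -> K) x ->
  integralOver (intr : int -> K) (q *: x).
Proof.
case/intrP => c -> xI; rewrite -mulr_algl intr_in_alg.
by apply: integral_mul => //; apply: integral_id.
Qed.

Lemma integral_sum (K : fieldExtType rat) (I : Type) (r : seq I) (P : pred I)
    (f : I -> K) :
  (forall i, P i -> integralOver (intr : int -> K) (f i)) ->
  integralOver (intr : int -> K) (\sum_(i <- r | P i) f i).
Proof.
move=> fI; apply: (big_ind (integralOver (intr : int -> K))) => //.
- exact: mxpoly.integral0.
- by move=> *; apply: integral_add.
Qed.

(** Each vector of a rational basis is multiplied by a nonzero integer that makes it integral. *)
Lemma integral_spanning_family (K : fieldExtType rat) (m : nat)
    (X : m.+1.-tuple K) (basX : basis_of {:K} X) :
  exists b : 'I_m.+1 -> K,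
    [/\ forall i, integralOver (intr : int -> K) (b i),
        forall y, exists q : 'I_m.+1 -> rat, y = \sum_i q i *: b i &
        forall q : 'I_m.+1 -> rat, \sum_i q i *: b i = 0 -> forall i, q i = 0].
Proof.
have /choice[c cP] : forall i : 'I_m.+1, exists c : int,
    c != 0 /\ integralOver (intr : int -> K) (X`_i *~ c).
  by move=> i; have [c] := @integral_clear_denominator K X`_i; exists c.
have bE (i : 'I_m.+1) : X`_i *~ c i = (c i)%:~R *: X`_i by rewrite scaler_int.
have cn0 (i : 'I_m.+1) : (c i)%:~R != 0 :> rat by rewrite intr_eq0; case: (cP i).
exists (fun i : 'I_m.+1 => X`_i *~ c i); split => [i|y|q q0 i].
- by case: (cP i).
- exists (fun i : 'I_m.+1 => coord X i y / (c i)%:~R).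
  rewrite {1}(coord_basis basX (memvf y)); apply: eq_bigr => i _.
  by rewrite bE scalerA divfK.
- have /freeP/(_ (fun i : 'I_m.+1 => q i * (c i)%:~R)) := basis_free basX.
  have -> : \sum_i (q i * (c i)%:~R) *: X`_i = 0.
    by rewrite -[RHS]q0; apply: eq_bigr => k _; rewrite bE scalerA.
  by move=> /(_ erefl i)/eqP; rewrite mulf_eq0 (negbTE (cn0 i)) orbF => /eqP.
Qed.

(* Among the integral families containing 1 at a fixed place, one with minimal
   nonzero |trdet| is a Z-basis: reducing a coordinate modulo 1 would make the
   determinant smaller. *)
Theorem integral_basis (K : fieldExtType rat) (m : nat) :
  \dim {:K} = m.+1 ->
  exists X : m.+1.-tuple K,
    [/\ basis_of {:K} X, X`_0 = 1 &
        forall y, ring_of_integers K y <->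
                  forall i, coord X i y \is a Num.int].
Proof.
move=> dimK.
have [X basX] : exists X : m.+1.-tuple K, basis_of {:K} X.
  by rewrite -dimK; exists (vbasis {:K}); apply: vbasisP.
have [b [bI bspan bfree]] := integral_spanning_family basX.
have [c cE] := bspan 1.
have [i0 ci0] : exists i, c i != 0.
  apply: contrapT => /forallNP c0; have := oner_neq0 K; rewrite cE big1 ?eqxx //.
  by move=> i _; have /negP := c0 i; rewrite negbK => /eqP ->; rewrite scale0r.
pose good (N : nat) := exists x : 'I_m.+1 -> K,
  [/\ forall i, integralOver (intr : int -> K) (x i), x i0 = 1,
      trdet X b x != 0 & `|trdet X b x| = N%:R].
have norm_nat x : (forall i, integralOver (intr : int -> K) (x i)) ->
    exists N : nat, `|trdet X b x| = N%:R.
  move=> xI; have /intrP[c0 ->] := trdet_int basX bI xI.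
  by exists `|c0|%N; rewrite natr_absz intr_norm.
have exgood : exists N, `[< good N >].
  (* The descent starts from [b] with 1 put in place i0; this multiplies the determinant by [c i0],
     which is nonzero. *)
  pose x k := if k == i0 then \sum_l c l *: b l else b k.
  have xI k : integralOver (intr : int -> K) (x k).
    by rewrite /x -cE; case: eqP => // _; apply: integral1.
  have [N NE] := norm_nat x xI; exists N; apply/asboolP; exists x; split => //.
    by rewrite /x eqxx.
  by rewrite trdet_replace mulf_neq0 // trdet_diag_neq0.
have [N0 /asboolP[x [xI xi0 dx dxN0]] minx] := ex_minnP exgood.
have xspan := trdet_span basX bspan dx.
have coord_int q : integralOver (intr : int -> K) (\sum_i q i *: x i) ->
    forall i, q i \is a Num.int.
  move=> yI; have qI i : i != i0 -> q i \is a Num.int.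
    (* Coordinate i is replaced by its fractional part; as i is not i0, the entry 1 survives in the
       new family. *)
    move=> ii0; pose f l := if l == i then q i - (Num.floor (q i))%:~R else q l.
    have [f0|fn0] := eqVneq (f i) 0.
      move: f0; rewrite /f eqxx => /eqP; rewrite subr_eq0 => /eqP ->.
      exact: intr_int.
    pose x' k := if k == i then \sum_l f l *: x l else x k.
    have fE : \sum_l f l *: x l = \sum_l q l *: x l - (Num.floor (q i))%:~R *: x i.
      rewrite (bigD1 i) //= [in RHS](bigD1 i) //= /f eqxx scalerBl addrAC.
      by congr (_ + _ - _); apply: eq_bigr => l /negbTE ->.
    have x'I k : integralOver (intr : int -> K) (x' k).
      rewrite /x'; case: eqP => // _; rewrite fE; apply: integral_sub => //.
      by apply: integral_scale_int => //; apply: intr_int.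
    have dx'E : trdet X b x' = f i * trdet X b x by rewrite trdet_replace.
    have [N NE] := norm_nat x' x'I.
    have /minx : `[< good N >].
      apply/asboolP; exists x'; split => //; last by rewrite dx'E mulf_neq0.
      by rewrite /x' eq_sym (negbTE ii0).
    rewrite -(ler_nat rat) -NE dx'E normrM -dxN0.
    rewrite ler_pMl ?normr_gt0 // leNgt.
    rewrite ger0_norm /f eqxx ?subr_ge0 ?Num.Theory.floor_le //.
    by rewrite ltrBlDr addrC -intrD1 floorD1_gt.
  (* At i0 the vector is 1: removing the other terms, already integral, leaves the rational number
     [q i0] integral over the integers. *)
  move=> i; have [-> {i}|] := eqVneq i i0; last exact: qI.
  apply: (@integral_intr_rat K).
  have -> : (q i0)%:A = \sum_i q i *: x i - \sum_(i | i != i0) q i *: x i.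
    by rewrite (bigD1 i0) //= addrK xi0.
  apply: integral_sub => //; apply: integral_sum => i ii0.
  by apply: integral_scale_int => //; apply: qI.
(* A transposition moves the vector 1 to index 0. *)
pose s := tperm i0 ord0.
pose t := [tuple x (s i) | i < m.+1].
have tE (i : 'I_m.+1) : t`_i = x (s i) by rewrite -tnth_nth tnth_mktuple.
have tspan y : exists q : 'I_m.+1 -> rat, y = \sum_i q i *: t`_i.
  have [q ->] := xspan y; exists (q \o s).
  rewrite (reindex_inj (@perm_inj _ s)) /=.
  by apply: eq_bigr => i _; rewrite tE.
have tbas : basis_of {:K} t.
  rewrite basisEdim size_tuple dimK leqnn andbT; apply/subvP => y _.
  have [q ->] := tspan y; apply: rpred_sum => i _; apply: rpredZ.
  by apply: memv_span; apply: mem_nth; rewrite size_tuple.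
exists t; split => //; first by rewrite (tE ord0) /s tpermR.
move=> y; rewrite /ring_of_integers /=; split => [|cI].
  rewrite {1}(coord_basis tbas (memvf y)) => yI i.
  have <- := tpermK i0 ord0 i.
  apply: (coord_int (fun i => coord t (s i) y)).
  rewrite (reindex_inj (@perm_inj _ s)) /=.
  congr (integralOver _ _): yI; apply: eq_bigr => k _.
  by rewrite tpermK tE.
rewrite (coord_basis tbas (memvf y)); apply: integral_sum => i _.
by apply: integral_scale_int => //; rewrite tE.
Qed.

(** * Computing indices and bounding cardinalities from below *)

(** The map [g] induces a bijection from the cosets of B in A to F, inverted by choosing
    representatives. *)
Lemma set_index_classes (V : zmodType) (A B : set V) (F : finType) (g : V -> F) :
  B 0 -> (forall x y, B x -> B y -> B (x - y)) ->
  (forall x y, A x -> A y -> (g x = g y <-> B (x - y))) ->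
  (forall f, exists2 x, A x & g x = f) ->
  finite_set (cosets A B) /\ set_index A B = #|F|.
Proof.
move=> B0 BB gP gsurj.
have /choice[r rP] : forall f, exists x, A x /\ g x = f.
  by move=> f; have [x ? ?] := gsurj f; exists x.
have BN x : B x -> B (- x) by rewrite -[- x]sub0r; apply: BB.
have BD x y : B x -> B y -> B (x + y).
  by move=> Bx /BN By; rewrite -[y]opprK; apply: BB.
pose h f := [set r f + b | b in B].
have hinj : injective h.
  move=> f f' hff'; have [Af <-] := rP f; have [Af' <-] := rP f'.
  apply/gP => //; have : h f (r f) by exists 0; rewrite ?addr0.
  by rewrite hff' => -[b Bb <-]; rewrite addrC addKr.
have cosetsE : cosets A B = [set h f | f in [set: F]].
  apply/seteqP; split => [_ [x Ax <-]|_ [f _ <-]]; last first.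
    by exists (r f) => //; case: (rP f).
  exists (g x) => //; have [Ar gr] := rP (g x).
  have Brx : B (r (g x) - x) by apply/gP.
  apply/seteqP; split => _ [b Bb <-].
    by exists (r (g x) - x + b); [apply: BD|rewrite addrA addrCA subrr addr0].
  by exists (b - (r (g x) - x)); [apply: BB|rewrite opprB addrC addrA subrK addrC].
have fin : finite_set (cosets A B).
  by rewrite cosetsE; apply: finite_image; apply: finite_finset.
split => //.
rewrite /set_index; have -> : fset_set (cosets A B) = [fset h f | f in F]%fset.
  apply/fsetP => Y; rewrite in_fset_set //; apply/idP/imfsetP.
    by rewrite inE cosetsE => -[f _ <-]; exists f.
  by move=> [f _ ->]; rewrite inE cosetsE; exists f.
by rewrite card_imfset //= -cardE.
Qed.

(** Finiteness of S matters: [fset_set] sends an infinite set to the empty one. *)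
Lemma leq_card_fset_set_inj (W : finType) (T : choiceType) (S : set T)
    (L : W -> T) :
  injective L -> finite_set S -> (forall w, S (L w)) ->
  (#|W| <= #|` fset_set S|)%N.
Proof.
move=> Linj Sfin SL; have <- : #|` [fset L w | w in W]%fset| = #|W|.
  by rewrite card_imfset //= -cardE.
apply: fsubset_leq_card; apply/fsubsetP => _ /imfsetP[w _ ->].
by rewrite in_fset_set // inE.
Qed.

(** * Finiteness of the set of orders of given index *)

Section Orders.
Variables (K : fieldExtType rat) (m : nat) (X : m.+1.-tuple K).
Hypothesis basX : basis_of {:K} X.
Hypothesis OKP : forall y, ring_of_integers K y <->
  forall i, coord X i y \is a Num.int.

(* Pigeonhole on 0, y, 2y, .., Ny among the N cosets. *)
Lemma order_fact_mul (N : nat) (O : set K) : (0 < N)%N ->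
  orders_of_index K N O -> forall y, ring_of_integers K y -> O (y *+ N`!).
Proof.
move=> N0 [[_ [one_O sub_O _] fin] idx] y yI.
have O1 : O 1 by move: one_O; rewrite inE.
have OB u v : O u -> O v -> O (u - v).
  by move=> Ou Ov; have := sub_O u v; rewrite !inE; apply.
have O0 : O 0 by rewrite -(subrr 1); apply: OB.
have yIn k : ring_of_integers K (y *+ k).
  elim: k => [|k IH]; first exact: mxpoly.integral0.
  by rewrite mulrS; apply: integral_add.
pose h (i : 'I_N.+1) := [set y *+ i + b | b in O].
have /injectivePn[i [j ij hij]] : ~~ injectiveb h.
  apply/negP => /injectiveP hinj; have := leq_card_fset_set_inj hinj fin.
  rewrite card_ord -/(set_index _ _) idx ltnn => hle.
  by suff : false by []; apply: hle => i; exists (y *+ i).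
wlog lt_ij : i j ij hij / (i < j)%N.
  move=> wlg; case: (ltngtP i j) => [|/[dup] ?|/val_inj ijE]; first exact: wlg.
    by apply: (wlg j i); rewrite ?[j == i]eq_sym.
  by rewrite ijE eqxx in ij.
have Oij : O (y *+ (j - i)).
  have : h j (y *+ j) by exists 0; rewrite ?addr0.
  by rewrite -hij => -[b Ob bE]; rewrite mulrnBr 1?ltnW // -bE addrAC subrr add0r.
have Omul k u : O u -> O (u *+ k).
  move=> Ou; elim: k => [//|k IH].
  rewrite mulrS -[u *+ k]opprK -[- (u *+ k)]sub0r.
  by apply: (OB _ _ Ou); apply: OB.
(* The pigeonhole gives only 0 < j - i <= N, and N! is a common multiple of all these values. *)
have /dvdn_fact/dvdnP[k ->] : (0 < j - i <= N)%N.
  by rewrite subn_gt0 lt_ij leq_subLR (leq_trans _ (leq_addl _ _)) // -ltnS.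
by rewrite mulnC mulrnA; apply: Omul.
Qed.

(* An order of index N contains N! O_K, hence is determined by its image in
   O_K / N! O_K. *)
Lemma finite_orders_of_index (N : nat) : (0 < N)%N ->
  finite_set (orders_of_index K N).
Proof.
move=> N0; have M0 := fact_gt0 N.
(* The elements [comb r] represent all classes of O_K / N! O_K, and [S O] records those lying in
   O. *)
pose comb (r : {ffun 'I_m.+1 -> 'I_N`!}) : K := \sum_(i < m.+1) X`_i *+ r i.
pose S (O : set K) : {set {ffun 'I_m.+1 -> 'I_N`!}} :=
  finset (fun r => `[< O (comb r) >]).
have combP y : ring_of_integers K y ->
    exists r w, ring_of_integers K w /\ y = comb r + w *+ N`!.
  move=> /OKP yI; pose z i := Num.floor (coord X i y).
  have N0' : (N`!%:Z != 0) by rewrite -lt0n in M0 *.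
  have zE i : `|(z i %% N`!)%Z|%N%:Z = (z i %% N`!)%Z.
    by rewrite gez0_abs // modz_ge0.
  have zlt i : (`|(z i %% N`!)%Z| < N`!)%N.
    by rewrite -ltz_nat zE ltz_pmod.
  exists [ffun i => Ordinal (zlt i)].
  exists (\sum_(i < m.+1) (z i %/ N`!)%Z%:~R *: X`_i); split.
    apply/OKP => i; rewrite coord_sum_free ?(basis_free basX) //.
  rewrite /comb -sumrMnl -big_split /= {1}(coord_basis basX (memvf y)).
  apply: eq_bigr => i _; rewrite ffunE /=.
  have := yI i; rewrite intrEfloor -/(z i) => /eqP <-.
  rewrite {1}(divz_eq (z i) N`!) addrC intrD intrM scalerDl.
  congr (_ + _); first by rewrite mulrC -scalerA -pmulrn scaler_nat.
  by rewrite -[in LHS]zE -pmulrn scaler_nat.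
have sub O1 O2 : orders_of_index K N O1 -> orders_of_index K N O2 ->
    S O1 = S O2 -> O1 `<=` O2.
  move=> O1P O2P S12 y O1y.
  have yI : ring_of_integers K y by case: O1P => -[+ _ _] _; apply.
  have [r [w [wI yE]]] := combP y yI.
  have BO O : orders_of_index K N O -> forall u v, O u -> O v -> O (u - v).
    by case=> -[_ [_ sub_O _] _] _ u v Ou Ov; have := sub_O u v; rewrite !inE; apply.
  (* N! w lies in both orders, so membership of y is decided by its representative [comb r]. *)
  have O1w : O1 (w *+ N`!) by apply: order_fact_mul.
  have O2w : O2 (- w *+ N`!).
    by apply: order_fact_mul => //; apply: integral_opp.
  have : r \in S O1.
    rewrite finset.in_set; apply/asboolP.
    by rewrite -[comb r](addrK (w *+ N`!)) -yE; apply: BO.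
  rewrite S12 finset.in_set => /asboolP O2r.
  by rewrite yE -[_ *+ _]opprK -mulNrn; apply: BO.
(* Choosing preimages under [S] puts all these orders in the image of a finite type. *)
pose orderof (s : {set {ffun 'I_m.+1 -> 'I_N`!}}) : set K :=
  xget set0 [set O | orders_of_index K N O /\ S O = s].
apply: (@sub_finite_set _ _ (range orderof)); last first.
  by apply: finite_image; apply: finite_finset.
move=> O OP; exists (S O) => //; rewrite /orderof.
case: xgetP => [P _ [PP SP]|/(_ O)]; last by case.
by apply/seteqP; split; apply: sub.
Qed.

End Orders.

(** * Residues and divisibility for integers inside the rationals *)

(** Taking the floor first makes reduction modulo n total on [rat], so it applies directly to
    coordinates. *)
Lemma exists_residue (n : nat) : (0 < n)%N -> exists res : rat -> 'I_n,
  (forall a b, a \is a Num.int -> b \is a Num.int ->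
     (res a = res b <-> (a - b) / n%:R \is a Num.int)) /\
  (forall i : 'I_n, res i%:R = i).
Proof.
move=> n0; have nZ : n%:Z != 0 by rewrite -lt0n in n0 *.
have zE (z : int) : `|(z %% n)%Z|%N%:Z = (z %% n)%Z.
  by rewrite gez0_abs // modz_ge0.
have zlt (z : int) : (`|(z %% n)%Z| < n)%N by rewrite -ltz_nat zE ltz_pmod.
exists (fun a => Ordinal (zlt (Num.floor a))); split => [_ _ /intrP[a ->] /intrP[b ->]|i].
  rewrite !intrKfloor -intrB; split => [[/(congr1 Posz)]|/intrP[c abE]].
    rewrite !zE => /eqP; rewrite eqz_mod_dvd => ?.
    exact: (@Qint_dvdz _ n).
  apply: val_inj => /=; congr absz; apply/eqP; rewrite eqz_mod_dvd.
  apply/dvdzP; exists c; apply: (@intr_inj rat); rewrite intrM -abE.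
  by rewrite divfK // pnatr_eq0 -lt0n.
apply: val_inj => /=; rewrite pmulrn intrKfloor.
by rewrite modz_small // ltz_nat ltn_ord.
Qed.

Lemma int_divN (q : rat) n : (0 < n)%N -> q / n%:R \is a Num.int -> q \is a Num.int.
Proof.
move=> n0 qn; have nQ0 : n%:R != 0 :> rat by rewrite pnatr_eq0 -lt0n.
rewrite -[q](divfK nQ0).
by apply: rpredM => //; apply: natr_int.
Qed.

(** * The order attached to a matrix modulo N *)

Section TwistedLattice.
Variables (K : fieldExtType rat) (d r : nat) (X : (d + r).+1.-tuple K).
Hypothesis basX : basis_of {:K} X.
Hypothesis X0 : X`_0 = 1.
Hypothesis OKP : forall y, ring_of_integers K y <->
  forall i, coord X i y \is a Num.int.
Variable N : nat.
Hypothesis N0 : (0 < N)%N.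

Let NQ0 : N%:R != 0 :> rat. Proof. by rewrite pnatr_eq0 -lt0n. Qed.

(** Index 0 belongs to the basis vector 1; the other d + r vectors are split into d left and r right
    ones. *)
Definition coordL (j : 'I_d) (y : K) : rat :=
  coord X (lift ord0 (lshift r j)) y.
Definition coordR (s : 'I_r) (y : K) : rat :=
  coord X (lift ord0 (rshift d s)) y.

HB.instance Definition _ j := GRing.Linear.copy (coordL j)
  (coord X (lift ord0 (lshift r j))).
HB.instance Definition _ s := GRing.Linear.copy (coordR s)
  (coord X (lift ord0 (rshift d s))).

Lemma ring_of_integers_coord y :
  ring_of_integers K y <-> [/\ coord X ord0 y \is a Num.int,
    forall j, coordL j y \is a Num.int & forall s, coordR s y \is a Num.int].
Proof.
rewrite OKP; split => [yI|[y0 yL yR] i]; first by split=> *; apply: yI.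
case: (unliftP ord0 i) => [k|] ->//.
by case: (split_ordP k) => l ->; [apply: yL|apply: yR].
Qed.

Lemma exists_coord (q : rat) (qL : 'I_d -> rat) (qR : 'I_r -> rat) :
  exists y, [/\ coord X ord0 y = q, forall j, coordL j y = qL j &
    forall s, coordR s y = qR s].
Proof.
pose f (i : 'I_(d + r).+1) : rat := if unlift ord0 i is Some k then
  match fintype.split (k : 'I_(d + r)) with inl j => qL j | inr s => qR s end else q.
exists (\sum_(i < (d + r).+1) f i *: X`_i).
have fE i : coord X i (\sum_(i < (d + r).+1) f i *: X`_i) = f i.
  by rewrite coord_sum_free // (basis_free basX).
split=> [|j|s]; rewrite /coordL /coordR fE /f ?unlift_none // liftK.
  by rewrite (unsplitK (inl j)).
by rewrite (unsplitK (inr s)).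
Qed.

Lemma coord1 i : coord X i 1 = (ord0 == i)%:R.
Proof. by have := coord_free ord0 i (basis_free basX); rewrite X0. Qed.

Lemma coordL1 j : coordL j 1 = 0.
Proof. exact: coord1. Qed.

Lemma coordR1 s : coordR s 1 = 0.
Proof. exact: coord1. Qed.

Section Matrix.
Variable A : {ffun 'I_d * 'I_r -> 'I_N}.

(** Coefficient of X_j once each right basis vector X_(d+s) is replaced by Y_s = X_(d+s) + sum_j
    A_(j,s) X_j. *)
Definition twist (j : 'I_d) (y : K) : rat :=
  coordL j y - \sum_s (A (j, s))%:R * coordR s y.

Lemma twist_is_linear j : linear (twist j : K -> rat^o).
Proof.
move=> a x y; rewrite /twist linearP /= scalerBr scaler_sumr [RHS]addrACA.
rewrite -opprD -big_split /=; congr (_ - _); apply: eq_bigr => s _.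
by rewrite linearP /= mulrDr; congr (_ + _); rewrite mulrCA.
Qed.

HB.instance Definition _ j := GRing.isLinear.Build rat K rat^o _ (twist j)
  (twist_is_linear j).

(* The lattice Z + N (Y_1 Z + .. + Y_r Z) + N^2 (X_1 Z + .. + X_d Z) with
   Y_s = X_(d+s) + sum_j A_(j,s) X_j. *)
Definition twisted_lattice : set K := [set y |
  [/\ coord X ord0 y \is a Num.int,
      forall s, coordR s y / N%:R \is a Num.int &
      forall j, twist j y / (N ^ 2)%:R \is a Num.int]].

Lemma twisted_lattice_sub : twisted_lattice `<=` ring_of_integers K.
Proof.
move=> y [y0 yR yL]; apply/ring_of_integers_coord.
have yR' s : coordR s y \is a Num.int by apply: int_divN N0 (yR s).
split => // j; rewrite -[coordL j y](subrK (\sum_s (A (j, s))%:R * coordR s y)).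
apply: rpredD; first by apply: int_divN (yL j); rewrite expn_gt0 N0.
by apply: rpred_sum => s _; apply: rpredM => //; apply: natr_int.
Qed.

Lemma twisted_latticeB x y :
  twisted_lattice x -> twisted_lattice y -> twisted_lattice (x - y).
Proof.
move=> [x0 xR xL] [y0 yR yL].
split => [|s|j]; rewrite linearB /=; first exact: rpredB.
  by rewrite (mulrBl _ (coordR s x)) rpredB.
by rewrite (mulrBl _ (twist j x)) rpredB.
Qed.

Lemma twisted_latticeZ q x : q \is a Num.int ->
  twisted_lattice x -> twisted_lattice (q *: x).
Proof.
move=> qI [x0 xR xL].
split => [|s|j]; rewrite linearZ /=; first exact: rpredM.
  by rewrite -(mulrA q) rpredM.
by rewrite -(mulrA q) rpredM.
Qed.

Lemma twisted_latticeD x y :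
  twisted_lattice x -> twisted_lattice y -> twisted_lattice (x + y).
Proof.
move=> xL yL; rewrite -[y]opprK -[- y]scaleN1r; apply: twisted_latticeB => //.
by apply: twisted_latticeZ => //; rewrite rpredN1.
Qed.

Lemma twisted_lattice1 : twisted_lattice 1.
Proof.
split => [|s|j]; first by rewrite coord1 rpred1.
  by rewrite coordR1 mul0r.
rewrite /twist coordL1 big1 ?subr0 ?mul0r // => s _.
by rewrite coordR1 mulr0.
Qed.

Lemma twist_int j y : ring_of_integers K y -> twist j y \is a Num.int.
Proof.
move=> /ring_of_integers_coord[_ yL yR]; apply: rpredB => //.
by apply: rpred_sum => s _; apply: rpredM => //; apply: natr_int.
Qed.

Lemma twisted_lattice_scale y :
  ring_of_integers K y -> twisted_lattice ((N ^ 2)%:R *: y).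
Proof.
move=> yI; have [y0 yL yR] := (ring_of_integers_coord y).1 yI.
split => [|s|j]; rewrite linearZ /=.
- by apply: rpredM => //; apply: natr_int.
- rewrite natrX expr2 -!mulrA mulrCA [_ / _]mulrC mulVKf //.
  by apply: rpredM => //; apply: natr_int.
- by rewrite mulrC mulKf ?twist_int // natrX expf_neq0.
Qed.

Lemma twisted_lattice_decomp y : twisted_lattice y ->
  exists2 w, ring_of_integers K w & y = (coord X ord0 y)%:A + N%:R *: w.
Proof.
move=> yL; have [y0 yR yT] := yL.
exists (N%:R^-1 *: (y - (coord X ord0 y)%:A)); last first.
  by rewrite scalerA divff // scale1r addrC subrK.
apply/ring_of_integers_coord; split => [|j|s]; rewrite linearZ linearB linearZ /=.
- by rewrite coord1 eqxx mulr1 subrr mulr0.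
- rewrite coordL1 mulr0 subr0 mulrC.
  (* The twist is divisible by N^2 and the right coordinates by N, hence the left coordinates are
     divisible by N. *)
  have -> : coordL j y / N%:R = twist j y / (N ^ 2)%:R * N%:R +
      \sum_s (A (j, s))%:R * (coordR s y / N%:R).
    under eq_bigr do rewrite mulrA; rewrite -mulr_suml /twist natrX; field.
    by [].
  apply: rpredD; first by apply: rpredM => //; apply: natr_int.
  by apply: rpred_sum => s _; apply: rpredM => //; apply: natr_int.
- by rewrite coordR1 mulr0 subr0 mulrC.
Qed.

(* uv lies in Z + Z u + Z v + N^2 O_K. *)
Lemma twisted_latticeM u v :
  twisted_lattice u -> twisted_lattice v -> twisted_lattice (u * v).
Proof.
move=> uL vL; have [u0 _ _] := uL; have [v0 _ _] := vL.
have [u' u'I uE] := twisted_lattice_decomp uL.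
have [v' v'I vE] := twisted_lattice_decomp vL.
set a := coord X ord0 u in u0 uE; set b := coord X ord0 v in v0 vE.
(* Expand (a + N u') (b + N v') and absorb N u' and N v' back into u and v. *)
have -> : u * v = (a *: v + b *: u - (a * b)%:A) + (N ^ 2)%:R *: (u' * v').
  rewrite natrX; move: uE vE; rewrite -!(mulr_algl _ v) -!(mulr_algl _ u).
  rewrite -!(mulr_algl _ (u' * v')) -!(mulr_algl _ u') -!(mulr_algl _ v').
  have -> : (a * b)%:A = a%:A * b%:A :> K by apply: (rmorphM (in_alg K)).
  have -> : (N%:R ^+ 2)%:A = N%:R%:A ^+ 2 :> K by apply: (rmorphXn (in_alg K)).
  by move=> -> ->; ring.
apply: twisted_latticeD.
  apply: twisted_latticeB; last first.
    by apply: twisted_latticeZ twisted_lattice1; apply: rpredM.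
  by apply: twisted_latticeD; apply: twisted_latticeZ.
by apply: twisted_lattice_scale; apply: integral_mul.
Qed.

(** A class is determined by the d twists modulo N^2 and the r right coordinates modulo N; the
    coordinate on 1 is only required to be an integer. *)
Lemma twisted_lattice_index :
  finite_set (cosets (ring_of_integers K) twisted_lattice) /\
  set_index (ring_of_integers K) twisted_lattice = (N ^ (2 * d + r))%N.
Proof.
have N20 : (0 < N ^ 2)%N by rewrite expn_gt0 N0.
have [res [resP resK]] := exists_residue N0.
have [res2 [res2P res2K]] := exists_residue N20.
pose g y :=
  ([ffun j : 'I_d => res2 (twist j y)], [ffun s : 'I_r => res (coordR s y)]).
have -> : (N ^ (2 * d + r))%N =
    #|{: {ffun 'I_d -> 'I_(N ^ 2)} * {ffun 'I_r -> 'I_N}}|.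
  by rewrite card_prod !card_ffun !card_ord expnD expnM.
apply: (set_index_classes (g := g)) => [|x y|x y xI yI|[f1 f2]].
- by rewrite -(subrr 1); apply: twisted_latticeB; apply: twisted_lattice1.
- exact: twisted_latticeB.
- have [x0 _ xR] := (ring_of_integers_coord x).1 xI.
  have [y0 _ yR] := (ring_of_integers_coord y).1 yI.
  split => [[/ffunP gL /ffunP gR]|[xy0 xyR xyT]].
    split=> [|s|j]; rewrite linearB /=; first exact: rpredB.
      by apply/resP => //; have := gR s; rewrite !ffunE.
    by apply/res2P; [exact: twist_int|exact: twist_int|have := gL j; rewrite !ffunE].
  congr pair; apply/ffunP => i; rewrite !ffunE.
    apply/res2P; [exact: twist_int|exact: twist_int|].
    by have := xyT i; rewrite linearB.
  by apply/resP => //; have := xyR i; rewrite linearB.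
(* The left coordinates are chosen so that the sum cancels in the twist, leaving [f1 j]. *)
- have [y [y0 yL yR]] := exists_coord 0
    (fun j => (f1 j)%:R + \sum_s (A (j, s))%:R * (f2 s)%:R) (fun s => (f2 s)%:R).
  exists y.
    apply/ring_of_integers_coord; rewrite y0; split => [//|j|s].
      rewrite yL rpredD ?natr_int ?rpred_sum // => s _.
      by apply: rpredM; apply: natr_int.
    by rewrite yR natr_int.
  congr pair; apply/ffunP => i; rewrite ffunE; last by rewrite yR resK.
  rewrite /twist yL; under [X in _ - X]eq_bigr do rewrite yR.
  by rewrite addrK res2K.
Qed.

Lemma twisted_lattice_order : orders_of_index K (N ^ (2 * d + r)) twisted_lattice.
Proof.
have [fin idx] := twisted_lattice_index.
split => //; split => //; first exact: twisted_lattice_sub.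
split => [|u v|u v]; rewrite !inE.
- exact: twisted_lattice1.
- exact: twisted_latticeB.
- exact: twisted_latticeM.
Qed.

End Matrix.

(** The vector N Y_s built from A lies in the lattice of A, and its j-th twist with respect to B is
    N (A_(j,s) - B_(j,s)). If the lattices agree, N^2 divides this, so the entries agree modulo N;
    being below N, they are equal. *)
Lemma twisted_lattice_inj : injective twisted_lattice.
Proof.
have [res [resP resK]] := exists_residue N0.
move=> A B AB; apply/ffunP => -[j s].
rewrite -[A _]resK -[B _]resK; apply/resP; rewrite ?natr_int //.
have [y [y0 yL yR]] := exists_coord 0
  (fun j => N%:R * (A (j, s))%:R) (fun s' => N%:R * (s' == s)%:R).
have twistE (C : {ffun 'I_d * 'I_r -> 'I_N}) i :
    twist C i y = N%:R * ((A (i, s))%:R - (C (i, s))%:R).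
  rewrite /twist yL mulrBr; congr (_ - _); rewrite (bigD1 s) //= big1 => [|s' s's].
    by rewrite addr0 yR eqxx mulr1 mulrC.
  by rewrite yR (negbTE s's) !mulr0.
have : twisted_lattice A y.
  split=> [|s'|i]; first by rewrite y0.
    by rewrite yR mulrAC divff // mul1r natr_int.
  by rewrite twistE subrr mulr0 mul0r.
rewrite AB => -[_ _ /(_ j)]; rewrite twistE natrX expr2 invfM mulrACA divff //.
by rewrite mul1r.
Qed.

End TwistedLattice.

(** * Lower bound for the number of orders *)

Theorem num_orders_ge (K : fieldExtType rat) (d r N : nat) :
  \dim {:K} = (d + r).+1 -> (0 < N)%N ->
  (N ^ (d * r) <= num_orders K (N ^ (2 * d + r)))%N.
Proof.
move=> dimK N0; have [X [basX X0 OKP]] := integral_basis dimK.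
have -> : (N ^ (d * r))%N = #|{ffun 'I_d * 'I_r -> 'I_N}|.
  by rewrite card_ffun card_prod !card_ord.
apply: (leq_card_fset_set_inj (L := twisted_lattice X (N := N))).
- exact: twisted_lattice_inj.
- by apply: finite_orders_of_index basX OKP _ _; rewrite expn_gt0 N0.
- by move=> A; apply: twisted_lattice_order.
Qed.

(** * Divergence of the local series *)

Lemma norm_natcpow (R : realType) (p : nat) (s : R[i]) :
  `|natcpow p s| = (expR (complex.Re s * ln p%:R))%:C%C.
Proof.
rewrite normc_def /natcpow /= !exprMn -mulrDr cos2Dsin2 mulr1 sqrtr_sqr.
by rewrite ger0_norm // expR_ge0.
Qed.

(** With N = p^k there are at least p^(k d r) orders of index p^(k (2d + r)), so the term has
    modulus at least p^(k (d r - Re(s) (2d + r))), whose exponent is nonnegative. *)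
Lemma ge1_norm_eta_term (R : realType) (K : fieldExtType rat) (p : nat)
    (s : R[i]) (d r k : nat) : (0 < p)%N -> \dim {:K} = (d + r).+1 ->
  complex.Re s * (2 * d + r)%:R <= (d * r)%:R ->
  1 <= `|eta_term K p s (k * (2 * d + r))|.
Proof.
move=> p0 dimK sle; rewrite /eta_term normrM normr_nat norm_natcpow.
have := @num_orders_ge K d r (p ^ k) dimK; rewrite expn_gt0 p0 -!expnM => /(_ isT).
move: (num_orders _ _) => M pM.
rewrite -(rmorph_nat (real_complex R)) -rmorphM /= lecR.
have pR : 0 < p%:R :> R by rewrite ltr0n.
apply: (@le_trans _ _ ((p ^ (k * (d * r)))%:R *
    expR (complex.Re (- ((k * (2 * d + r))%:R * s)) * ln p%:R))); last first.
  by rewrite ler_wpM2r ?expR_ge0 // ler_nat.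
have -> : complex.Re (- ((k * (2 * d + r))%:R * s)) =
    - ((k * (2 * d + r))%:R * complex.Re s).
  by rewrite -(rmorph_nat (real_complex R)); case: (s) => x y /=; ring.
have lnp : 0 <= ln (p%:R : R) by rewrite ln_ge0 // ler1n.
rewrite natrX -[X in X ^+ _](@lnK _ p%:R) ?posrE // -expRM_natl -expRD.
rewrite -[leLHS]expR0 ler_expR -mulrDl mulr_ge0 // subr_ge0.
by rewrite !natrM -mulrA ler_wpM2l ?ler0n // -natrM mulrC.
Qed.

Lemma eta_diverges (R : realType) (K : fieldExtType rat) (p : nat)
    (s : R[i]) (d r : nat) : (0 < p)%N -> \dim {:K} = (d + r).+1 ->
  (0 < d + r)%N ->
  complex.Re s * (2 * d + r)%:R <= (d * r)%:R -> ~ eta_converges K p s.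
Proof.
move=> p0 dimK dr0 sle /cvg_series_cvg_0/cvgr0Pnorm_lt/(_ 1 ltr01)[e _ small].
(* Since 2d + r is positive, e (2d + r) is not below the rank e from which all terms have modulus
   less than 1. *)
have /small /= lt1 : (e <= e * (2 * d + r))%N by rewrite leq_pmulr //; lia.
by have := le_lt_trans (ge1_norm_eta_term e p0 dimK sle) lt1; rewrite ltxx.
Qed.

(* Complete the square: with m = n - 1 and u = m + d the d-th term of c7 is
   (3 - 2 sqrt 2) m - (u - sqrt 2 m)^2 / u; take u nearest to sqrt 2 m. *)
Lemma c7_ge (R : realType) (n : nat) : (1 < n)%N ->
  (3 - 2 * Num.sqrt 2) * (n%:R - 1) + 1 - Num.sqrt 2 <= c7 R n.
Proof.
case: n => [//|m] m0; rewrite /c7 -(natr1 m) addrK.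
have mR : 1 <= m%:R :> R by rewrite ler1n.
set w := Num.sqrt 2.
have w2 : w ^+ 2 = 2 by rewrite sqr_sqrtr.
have w0 : 0 <= w by apply: sqrtr_ge0.
have w_ge : 7 / 5 <= w by nra.
have w_le : w <= 3 / 2 by nra.
(* Truncating after adding 1/2 rounds [w * m%:R] to a nearest integer. *)
pose u := Num.truncn (w * m%:R + 1 / 2).
have /andP[u_le u_gt] : u%:R <= w * m%:R + 1 / 2 < u.+1%:R.
  by apply: truncn_itv; nra.
rewrite -(natr1 u) in u_gt.
(* This bound and the next make d = u - m an admissible index, 0 <= d <= m. *)
have mu : (m <= u)%N.
  by rewrite -ltnS -(ltr_nat R) -(natr1 u); nra.
have um : (u - m < m.+1)%N.
  by rewrite ltn_subLR // -(ltr_nat R) natrD -(natr1 m); nra.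
apply: le_trans (le_bigmax _ _ (Ordinal um)); rewrite /=.
have uR : 1 <= u%:R :> R by rewrite (le_trans mR) // ler_nat.
rewrite natrB // [_ + (_ - _)]addrC subrK ler_pdivlMr; last by lra.
move: (m%:R) (u%:R) mR uR u_le u_gt => M U M1 U1 u_le u_gt.
have sq : (U - w * M) ^+ 2 <= 1 / 4 by nra.
have -> : (U - M) * (M - (U - M)) = (3 - 2 * w) * M * U - (U - w * M) ^+ 2.
  have -> : (U - w * M) ^+ 2 = U ^+ 2 - 2 * w * M * U + w ^+ 2 * M ^+ 2 by ring.
  rewrite w2; ring.
(* What remains is (U - w M)^2 <= (w - 1) U: the left side is at most 1/4, while w - 1 >= 2/5 and U
   >= 1. *)
by nra.
Qed.

Unset Implicit Arguments.
Set Strict Implicit.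

Theorem theorem6p3 (R : realType) (n : nat) (K : fieldExtType rat) (p : nat)
    (hn : (1 < n)%N) (hK : (\dim {:K})%VS = n) (hp : prime p) :
  (forall s : R[i], complex.Re s <= c7 R n / 2 -> ~ eta_converges K p s) /\
  (forall s : R[i],
     complex.Re s <=
       ((3 - 2 * Num.sqrt 2) * (n%:R - 1) + 1 - Num.sqrt 2) / 2 ->
     ~ eta_converges K p s).
Proof.
have div_c7 (s : R[i]) : complex.Re s <= c7 R n / 2 -> ~ eta_converges K p s.
  move=> s_le s_cvg.
  case: n hn hK s_le => [//|m] m0 dimK; apply/negP; rewrite -ltNge ltr_pdivrMr //.
  (* Convergence forces every fraction in the maximum below Re(s), by [eta_diverges] with r = m -
     d. *)
  have below d : (d < m.+1)%N ->
      d%:R * (m.+1%:R - 1 - d%:R) / (m.+1%:R - 1 + d%:R) < complex.Re s.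
    rewrite ltnS => dm; rewrite ltNge; apply/negP => s_le.
    have dimK' : \dim {:K} = (d + (m - d)).+1 by rewrite subnKC.
    apply: (eta_diverges (prime_gt0 hp) dimK' _ _ s_cvg); first by rewrite subnKC.
    have E : (m.+1%:R - 1 + d%:R : R) = (2 * d + (m - d))%:R.
      by rewrite -natr1 addrK -natrD; congr _%:R; lia.
    rewrite E ler_pdivlMr ?ltr0n in s_le; last by lia.
    by rewrite natrM natrB // -[m%:R](addrK 1) natr1.
  (* The fraction for d = 0 is 0, so Re(s) > 0; this covers the initial value 0 of the maximum and
     the passage from Re(s) to 2 Re(s). *)
  have s_gt0 : 0 < complex.Re s by have := below 0%N isT; rewrite !mul0r.
  have s2 : complex.Re s < complex.Re s * 2 by rewrite mulr_natr mulr2n ltrDl.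
  apply/bigmax_ltP; split => [|[d dm] _]; first exact: lt_trans s2.
  by apply: lt_trans s2; apply: below.
split => // s s_le; apply: div_c7; apply: le_trans s_le _.
by rewrite ler_pM2r ?invr_gt0 // c7_ge.
Qed.
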